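(* Let $H$ be a finite-dimensional cocommutative Hopf algebra, $(A,\cdot,(\omega,\omega'))$ a symmetric twisted partial $H$-module algebra, and $t\neq0$ a left integral in $H$. Assume there exists $c$ in the center of $A$ with $t\cdot c=1_A$. Then $A\subset A\#_{\cdot,\omega}H$ is a separable extension, i.e. there exists $e\in (A\#_{\cdot,\omega}H)\otimes_A(A\#_{\cdot,\omega}H)$ with $(x\otimes_A 1)e=e(1\otimes_A x)$ for all $x\in A\#_{\cdot,\omega}H$ and $m(e)=1_A\#1_H$, where $m$ is the multiplication map.
   Context: $k$ a field, $H$ a Hopf algebra with Sweedler notation $\Delta(h)=h_{(1)}\otimes h_{(2)}$, counit $\varepsilon$, antipode $S$; a left integral is $t\in H$ with $ht=\varepsilon(h)t$ for all $h$. $A$ a unital algebra. A twisted partial action: linear maps $h\otimes a\mapsto h\cdot a$, $\omega:H\otimes H\to A$ with $1_H\cdot a=a$, $h\cdot(ab)=(h_{(1)}\cdot a)(h_{(2)}\cdot b)$, (T3) $(h_{(1)}\cdot(l_{(1)}\cdot a))\omega(h_{(2)},l_{(2)})=\omega(h_{(1)},l_{(1)})(h_{(2)}l_{(2)}\cdot a)$, $\omega(h,l)=\omega(h_{(1)},l_{(1)})(h_{(2)}l_{(2)}\cdot 1_A)$; (N) $\omega(1_H,h)=\omega(h,1_H)=h\cdot 1_A$; (C) $(h_{(1)}\cdot\omega(l_{(1)},m_{(1)}))\omega(h_{(2)},l_{(2)}m_{(2)})=\omega(h_{(1)},l_{(1)})\omega(h_{(2)}l_{(2)},m)$. $A\#_{\cdot,\omega}H$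 is the span in $A\otimes H$ of $a\# h:=a(h_{(1)}\cdot 1_A)\otimes h_{(2)}$ with product $(a\otimes h)(b\otimes l)=a(h_{(1)}\cdot b)\omega(h_{(2)},l_{(1)})\otimes h_{(3)}l_{(2)}$, a unital associative algebra containing $A$ via $a\mapsto a\#1_H$. Convolution: $(f*g)(h)=f(h_{(1)})g(h_{(2)})$. With $e(h)=h\cdot1_A$, $f_1(h,k)=(h\cdot 1_A)\varepsilon(k)$, $f_2(h,k)=hk\cdot1_A$, the twisted partial action is symmetric if $e$ is central in $\mathrm{Hom}(H,A)$, $f_1,f_2$ are central in $\mathrm{Hom}(H\otimes H,A)$, $\omega$ satisfies (N),(T3),(C) and has a convolution inverse $\omega'$ with $\omega*\omega'=\omega'*\omega=f_1*f_2$, and $h\cdot(k\cdot1_A)=(h_{(1)}\cdot1_A)(h_{(2)}k\cdot1_A)$ for all $h,k\in H$. *)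

(* Defs.v *)
From HB Require Import structures.
From mathcomp Require Import all_boot all_order all_algebra all_field.
Set Implicit Arguments. Unset Strict Implicit. Unset Printing Implicit Defensive.
Import GRing.Theory.
Local Open Scope ring_scope.

(* We fix the canonical basis b := vbasis {:H} of H, of size d = \dim {:H}.  *)
(* The tensor square H (x) H is represented by d x d matrices over k:        *)
(*   tens u v := (coord_i(u) * coord_j(v))_{i,j}   ("u (x) v").             *)
(* A coproduct is a map Delta : H -> 'M[k]_d.  A Sweedler sum                *)
(*   sum f(h_(1), h_(2))  (f bilinear, values in a k-module V)              *)
(* is  sw (Delta h) f := \sum_{i,j} (Delta h)_{ij} *: f b_i b_j ,            *)
(* which is the value on Delta h of the linear map H(x)H -> V induced by f. *)

Section Defs.
Context {k : fieldType} {H : falgType k}.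

Definition dimH := \dim (fullv : {vspace H}).
Definition bH : dimH.-tuple H := vbasis fullv.
Definition bas (i : 'I_dimH) : H := tnth bH i.

Definition lin (U V : lmodType k) (f : U -> V) : Prop :=
  forall (c : k) (x y : U), f (c *: x + y) = c *: f x + f y.

Definition bilin (U W V : lmodType k) (f : U -> W -> V) : Prop :=
  (forall x, lin (f x)) /\ (forall y, lin (fun x => f x y)).

Definition tens (u v : H) : 'M[k]_dimH :=
  \matrix_(i, j) (coord bH i u * coord bH j v).

Definition sw (V : lmodType k) (D : 'M[k]_dimH) (f : H -> H -> V) : V :=
  \sum_(i < dimH) \sum_(j < dimH) D i j *: f (bas i) (bas j).

Definition is_hopf (Delta : H -> 'M[k]_dimH) (eps : H -> k) (S : H -> H) : Prop :=
  [/\ lin Delta /\ lin (eps : H -> k^o) /\ lin S,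
      (* coassociativity (Delta (x) id) Delta = (id (x) Delta) Delta, in coordinates
         of H (x) H (x) H *)
      (forall h p q r,
        \sum_(i < dimH) Delta h i r * Delta (bas i) p q
        = \sum_(j < dimH) Delta h p j * Delta (bas j) q r),
      (forall h, sw (Delta h) (fun x y => eps x *: y) = h) /\
      (forall h, sw (Delta h) (fun x y => eps y *: x) = h),
      [/\ Delta 1 = tens 1 1,
          (forall h l, Delta (h * l) =
             sw (Delta h) (fun x y => sw (Delta l) (fun x' y' => tens (x * x') (y * y')))),
          eps 1 = 1 &
          (forall h l, eps (h * l) = eps h * eps l)] &
      (forall h, sw (Delta h) (fun x y => S x * y) = eps h *: 1) /\
      (forall h, sw (Delta h) (fun x y => x * S y) = eps h *: 1)].

Definition cocommutative (Delta : H -> 'M[k]_dimH) : Prop :=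
  forall h, (Delta h)^T = Delta h.

Definition left_integral (eps : H -> k) (t : H) : Prop :=
  forall h, h * t = eps h *: t.

Section Action.
Context {A : algType k}.
Variables (Delta : H -> 'M[k]_dimH) (eps : H -> k).
Variables (act : H -> A -> A) (omega : H -> H -> A).

Definition conv (f g : H -> A) : H -> A :=
  fun h => sw (Delta h) (fun x y => f x * g y).

(* Convolution product in Hom(H (x) H, A), linear maps H (x) H -> A being
   represented by bilinear maps H -> H -> A; the coalgebra structure of
   H (x) H is Delta(h (x) l) = (h1 (x) l1) (x) (h2 (x) l2). *)
Definition conv2 (f g : H -> H -> A) : H -> H -> A :=
  fun h l => sw (Delta h) (fun x y => sw (Delta l) (fun x' y' => f x x' * g y y')).

Definition e_map : H -> A := fun h => act h 1.
Definition f1_map : H -> H -> A := fun h l => eps l *: act h 1.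
Definition f2_map : H -> H -> A := fun h l => act (h * l) 1.

Definition central_Hom (f : H -> A) : Prop :=
  forall g : H -> A, lin g -> conv f g = conv g f.
Definition central_Hom2 (f : H -> H -> A) : Prop :=
  forall g : H -> H -> A, bilin g -> conv2 f g = conv2 g f.

Definition T3 : Prop :=
  forall h l a,
    sw (Delta h) (fun x y => sw (Delta l) (fun x' y' => act x (act x' a) * omega y y'))
    = sw (Delta h) (fun x y => sw (Delta l) (fun x' y' => omega x x' * act (y * y') a)).

Definition N_cond : Prop :=
  forall h, omega 1 h = act h 1 /\ omega h 1 = act h 1.

Definition C_cond : Prop :=
  forall h l m,
    sw (Delta h) (fun x y => sw (Delta l) (fun x' y' => sw (Delta m) (fun x'' y'' =>
        act x (omega x' x'') * omega y (y' * y''))))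
    = sw (Delta h) (fun x y => sw (Delta l) (fun x' y' => omega x x' * omega (y * y') m)).

Definition twisted_partial_action : Prop :=
  [/\ ((forall a, lin (fun h => act h a)) /\ (forall h, lin (act h))) /\
      bilin omega,
      (forall a, act 1 a = a),
      (forall h a b, act h (a * b) = sw (Delta h) (fun x y => act x a * act y b)),
      T3 &
      (forall h l, omega h l =
         sw (Delta h) (fun x y => sw (Delta l) (fun x' y' => omega x x' * act (y * y') 1)))].

Definition symmetric_tpa (omega' : H -> H -> A) : Prop :=
  [/\ twisted_partial_action /\
      central_Hom e_map,
      central_Hom2 f1_map /\ central_Hom2 f2_map,
      N_cond /\ T3 /\ C_cond,
      bilin omega' /\
      conv2 omega omega' = conv2 f1_map f2_map /\
      conv2 omega' omega = conv2 f1_map f2_map &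
      (forall h l, act h (act l 1) = sw (Delta h) (fun x y => act x 1 * act (y * l) 1))].

(* A (x) H is represented as {ffun 'I_dimH -> A}: X stands for
   \sum_i X i (x) bas i. *)
Definition AH := {ffun 'I_dimH -> A}.

Definition atens (a : A) (h : H) : AH := [ffun i => coord bH i h *: a].

Definition cpmul_el (a : A) (h : H) (b : A) (l : H) : AH :=
  sw (Delta h) (fun h1 h23 => sw (Delta h23) (fun h2 h3 => sw (Delta l) (fun l1 l2 =>
      atens (a * act h1 b * omega h2 l1) (h3 * l2)))).

Definition cpmul (X Y : AH) : AH :=
  \sum_(i < dimH) \sum_(j < dimH) cpmul_el (X i) (bas i) (Y j) (bas j).

Definition cp (a : A) (h : H) : AH := sw (Delta h) (fun x y => atens (a * act x 1) y).

Definition in_cp (X : AH) : Prop :=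
  exists s : seq (A * H), X = \sum_(p <- s) cp p.1 p.2.

Definition balanced (M : zmodType) (beta : AH -> AH -> M) : Prop :=
  [/\ (forall X X' Y, in_cp X -> in_cp X' -> in_cp Y ->
          beta (X + X') Y = beta X Y + beta X' Y),
      (forall X Y Y', in_cp X -> in_cp Y -> in_cp Y' ->
          beta X (Y + Y') = beta X Y + beta X Y') &
      (forall X Y (a : A), in_cp X -> in_cp Y ->
          beta (cpmul X (cp a 1)) Y = beta X (cpmul (cp a 1) Y))].

(* equality in (A#H) (x)_A (A#H) of the elements \sum_{p in s1} p.1 (x) p.2 and
   \sum_{p in s2} p.1 (x) p.2 (all entries in A#H): by the universal property
   of the tensor product over A, they agree under every A-balanced map. *)
Definition tensA_eq (s1 s2 : seq (AH * AH)) : Prop :=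
  forall (M : zmodType) (beta : AH -> AH -> M), balanced beta ->
    \sum_(p <- s1) beta p.1 p.2 = \sum_(p <- s2) beta p.1 p.2.

Definition separable_cp : Prop :=
  exists es : seq (AH * AH),
    [/\ (forall p, p \in es -> in_cp p.1 /\ in_cp p.2),
        (forall x, in_cp x ->
           tensA_eq [seq (cpmul x p.1, p.2) | p <- es]
                    [seq (p.1, cpmul p.2 x) | p <- es]) &
        \sum_(p <- es) cpmul p.1 p.2 = cp 1 1].

End Action.
End Defs.

(* Main.v *)
Require Import Defs.
From HB Require Import structures.
From mathcomp Require Import all_boot all_order all_algebra all_field.
Import GRing.Theory.
Local Open Scope ring_scope.
Set Implicit Arguments. Unset Strict Implicit. Unset Printing Implicit Defensive.

(* Write Gam h = 1 # h. By cocommutativity the formula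
     Gaminv h = Gam (S h1) (omega' (h2, S h3) (h4 . 1))
   gives Gam h1 Gaminv h2 = h . 1 and Gaminv h1 a Gam h2 in A for all a in A.
   The separability element is the Casimir-type element
     e = Gam t1 c (x)_A Gaminv t2,
   so that m(e) = (t1 . c) Gam t2 Gaminv t3 = t . c = 1. Moving elements of A
   across the tensor sign gives
     a Gam l c (x) Y = Gam l1 c (x) Gaminv l2 a Gam l3 Y,
   whence a e = e a, and, after expanding Gam h Gam t1 as
   omega (h1, t1) Gam (h2 t2),
     Gam h e = Gam (h1 t1) c (x) Gaminv (h2 t2) Gam h3 = e Gam h,
   the last equality because t is a left integral.
   An equality in (A#H) (x)_A (A#H) is tested in (A#H)^d, a k-module, through
   X (x) (sum_j y_j # b_j) |-> (X y_j)_j. *)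

(** * Linear and bilinear maps *)

Section Linear.
Context {k : fieldType}.
Implicit Types U V W : lmodType k.

Lemma lin0 U V (f : U -> V) : lin f -> f 0 = 0.
Proof. by move=> fL; have := fL (-1) 0 0; rewrite !scaleN1r oppr0 addr0 addNr. Qed.

Lemma linD U V (f : U -> V) : lin f -> {morph f : x y / x + y}.
Proof. by move=> fL x y; have := fL 1 x y; rewrite !scale1r. Qed.

Lemma linZ U V (f : U -> V) : lin f -> forall c x, f (c *: x) = c *: f x.
Proof. by move=> fL c x; have := fL c x 0; rewrite (lin0 fL) !addr0. Qed.

Lemma lin_sum U V (f : U -> V) I (r : seq I) (P : pred I) (F : I -> U) :
  lin f -> f (\sum_(i <- r | P i) F i) = \sum_(i <- r | P i) f (F i).
Proof. by move=> fL; apply: big_morph; [exact: linD | exact: lin0]. Qed.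

Lemma lin_id U : lin (fun x : U => x).
Proof. by []. Qed.

Lemma lin_comp U V W (g : V -> W) (f : U -> V) :
  lin g -> lin f -> lin (fun x => g (f x)).
Proof. by move=> gL fL c x y; rewrite fL gL. Qed.

Lemma lin_bigsum U V I (r : seq I) (F : I -> U -> V) :
  (forall i, lin (F i)) -> lin (fun x => \sum_(i <- r) F i x).
Proof.
by move=> FL c x y; rewrite scaler_sumr -big_split; apply: eq_bigr => i _; exact: FL.
Qed.

Lemma lin_scale U V (f : U -> V) c : lin f -> lin (fun x => c *: f x).
Proof. by move=> fL a x y; rewrite fL scalerDr !scalerA mulrC. Qed.

Lemma lin_scalel U V (f : U -> k^o) (v : V) : lin f -> lin (fun x => (f x : k) *: v).
Proof. by move=> fL a x y; rewrite fL scalerDl scalerA. Qed.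

Lemma lin_mull U (A : algType k) (f : U -> A) a : lin f -> lin (fun x => f x * a).
Proof. by move=> fL c x y; rewrite fL mulrDl scalerAl. Qed.

Lemma lin_mulr U (A : algType k) (f : U -> A) a : lin f -> lin (fun x => a * f x).
Proof. by move=> fL c x y; rewrite fL mulrDr scalerAr. Qed.

Lemma bilin1 U V W (f : U -> V -> W) y : bilin f -> lin (fun x => f x y).
Proof. by case. Qed.

Lemma bilin2 U V W (f : U -> V -> W) x : bilin f -> lin (f x).
Proof. by case. Qed.

End Linear.

(** * Sweedler sums in coordinates *)

Section SwBasics.
Context {k : fieldType} {H : falgType k}.
Implicit Types (V W : lmodType k) (D E : 'M[k]_(@dimH k H)) (h : H).

Lemma bas_expand h : h = \sum_i coord bH i h *: bas i.
Proof.
rewrite {1}(coord_vbasis (memvf h)); apply: eq_bigr => i _.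
by rewrite /bas (tnth_nth 0).
Qed.

Lemma lin_bas V (f : H -> V) h : lin f -> f h = \sum_i coord bH i h *: f (bas i).
Proof.
move=> fL; rewrite {1}(bas_expand h) lin_sum //.
by apply: eq_bigr => i _; rewrite linZ.
Qed.

Lemma coord_bas i j : coord bH i (bas j : H) = (i == j)%:R.
Proof.
have fr : free (bH : seq H) by apply: basis_free (vbasisP _).
by rewrite /bas (tnth_nth 0) eq_sym; exact: coord_free.
Qed.

Lemma eq_sw V D (f g : H -> H -> V) :
  (forall x y, f x y = g x y) -> sw D f = sw D g.
Proof. by move=> fg; do 2!apply: eq_bigr => ? _; rewrite fg. Qed.

Lemma sw_pair V D (f : H -> H -> V) :
  sw D f = \sum_p D p.1 p.2 *: f (bas p.1) (bas p.2).
Proof. exact: (pair_bigA _ (fun i j => D i j *: f (bas i) (bas j))). Qed.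

Lemma sw_exch V D E (F : H -> H -> H -> H -> V) :
  sw D (fun x y => sw E (fun a b => F x y a b))
  = sw E (fun a b => sw D (fun x y => F x y a b)).
Proof.
rewrite !sw_pair.
under eq_bigr => i _ do rewrite sw_pair scaler_sumr.
under [RHS]eq_bigr => i _ do rewrite sw_pair scaler_sumr.
rewrite exchange_big; apply: eq_bigr => i _; apply: eq_bigr => j _.
by rewrite !scalerA mulrC.
Qed.

Lemma sw_sum V D I (r : seq I) (F : I -> H -> H -> V) :
  sw D (fun x y => \sum_(i <- r) F i x y) = \sum_(i <- r) sw D (F i).
Proof.
rewrite sw_pair; under eq_bigr => p _ do rewrite scaler_sumr.
by rewrite exchange_big; apply: eq_bigr => i _; rewrite sw_pair.
Qed.

Lemma lin_sw V W D (g : V -> W) (F : H -> H -> V) :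
  lin g -> g (sw D F) = sw D (fun x y => g (F x y)).
Proof.
move=> gL; rewrite /sw lin_sum //; apply: eq_bigr => i _.
by rewrite lin_sum //; apply: eq_bigr => j _; rewrite linZ.
Qed.

Lemma swZ V D c (f : H -> H -> V) : c *: sw D f = sw D (fun x y => c *: f x y).
Proof. exact: (lin_sw D f (lin_scale c (@lin_id _ V))). Qed.

Lemma sw_lin_arg V (U : lmodType k) D (F : U -> H -> H -> V) :
  (forall x y, lin (fun u => F u x y)) -> lin (fun u : U => sw D (F u)).
Proof.
move=> FL; rewrite /sw; apply: lin_bigsum => i; apply: lin_bigsum => j.
exact: lin_scale.
Qed.

Lemma sw_lin_mx V (F : H -> H -> V) : lin (fun D => sw D F).
Proof.
move=> c D E; rewrite /sw scaler_sumr -big_split; apply: eq_bigr => i _.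
rewrite scaler_sumr -big_split; apply: eq_bigr => j _.
by rewrite !mxE scalerDl scalerA.
Qed.

Lemma sw_tens V (F : H -> H -> V) u v : bilin F -> sw (tens u v) F = F u v.
Proof.
case=> FL FR; rewrite (lin_bas u (FR v)) /sw.
apply: eq_bigr => i _; rewrite (lin_bas v (FL _)) scaler_sumr.
by apply: eq_bigr => j _; rewrite mxE scalerA.
Qed.

End SwBasics.

(** * Reordering Sweedler sums over a cocommutative coalgebra *)

Section Reordering.
Context {k : fieldType} (X : Type).
Variable sg : forall V : lmodType k, X -> (X -> X -> V) -> V.
Implicit Types (V : lmodType k) (h : X).

(* [sg h f] stands for [sum f(h_1, h_2)]. As [sw] evaluates [f] on basis vectors
   only, these laws hold for arbitrary, not necessarily bilinear, [f]. *)
Definition sweedler_like : Prop :=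
  [/\ forall (V : lmodType k) h (f g : X -> X -> V), (forall x y, f x y = g x y) ->
        sg h f = sg h g,
      forall (V : lmodType k) h (f : X -> X -> V), sg h f = sg h (fun x y => f y x) &
      forall (V : lmodType k) h (f : X -> X -> X -> V),
        sg h (fun x y => sg x (fun p q => f p q y))
        = sg h (fun x y => sg y (fun q r => f x q r))].

Hypothesis sgP : sweedler_like.

Lemma sgE V h (f g : X -> X -> V) : (forall x y, f x y = g x y) -> sg h f = sg h g.
Proof. by case: sgP => e _ _; exact: e. Qed.

Lemma sgC V h (f : X -> X -> V) : sg h f = sg h (fun x y => f y x).
Proof. by case: sgP => _ e _; exact: e. Qed.

Lemma sgA V h (f : X -> X -> X -> V) :
  sg h (fun x y => sg x (fun p q => f p q y))
  = sg h (fun x y => sg y (fun q r => f x q r)).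
Proof. by case: sgP => _ _ e; exact: e. Qed.

Lemma sgCA V h (f : X -> X -> X -> V) :
  sg h (fun x y => sg y (fun q r => f x q r))
  = sg h (fun x y => sg y (fun q r => f q x r)).
Proof. by rewrite -!sgA; apply: sgE => x y; rewrite sgC. Qed.

Lemma sgAC V h (f : X -> X -> X -> V) :
  sg h (fun x y => sg x (fun p q => f p q y))
  = sg h (fun x y => sg x (fun p q => f p y q)).
Proof. by rewrite !sgA; apply: sgE => x y; rewrite sgC. Qed.

Lemma sgACA V h (f : X -> X -> X -> X -> V) :
  sg h (fun x y => sg x (fun p q => sg y (fun r s => f p q r s)))
  = sg h (fun x y => sg x (fun p q => sg y (fun r s => f p r q s))).
Proof.
rewrite (sgA _ (fun p q y => sg y (fun r s => f p q r s))).
rewrite (sgA _ (fun p q y => sg y (fun r s => f p r q s))).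
by apply: sgE => p z; rewrite sgCA.
Qed.

(** Both sides sum [f] over a fourfold coproduct. On the right the first and last arguments of [f]
    come from one common leg [z], which is what recombining them in [beta_Gam_Gam] requires. *)
Lemma sgCAA V h (f : X -> X -> X -> X -> V) :
  sg h (fun a z => sg z (fun x w => sg w (fun p q => f a x p q)))
  = sg h (fun y z => sg y (fun x p => sg z (fun a q => f a x p q))).
Proof.
rewrite (sgCA _ (fun a x w => sg w (fun p q => f a x p q))).
rewrite (sgA _ (fun x p z => sg z (fun a q => f a x p q))).
by apply: sgE => x z; rewrite sgCA.
Qed.

End Reordering.

(** * Tensor products of coalgebras *)

Section ProductReordering.
Context {k : fieldType} (X1 X2 : Type).
Variable sg1 : forall V : lmodType k, X1 -> (X1 -> X1 -> V) -> V.
Variable sg2 : forall V : lmodType k, X2 -> (X2 -> X2 -> V) -> V.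

Definition sg_prod (V : lmodType k) (h : X1 * X2) (f : X1 * X2 -> X1 * X2 -> V) : V :=
  sg1 h.1 (fun x y => sg2 h.2 (fun x' y' => f (x, x') (y, y'))).

(** Since sums over the two factors commute, nested sums can be sorted by factor, and each law then
    holds factor by factor. Applied to H (x) H and H (x) H (x) H, this lets identities in two or
    three variables be reordered as if they had one. *)
Lemma sg_prod_sweedler :
  sweedler_like sg1 -> sweedler_like sg2 ->
  (forall (V : lmodType k) h l (f : X1 -> X1 -> X2 -> X2 -> V),
    sg1 h (fun x y => sg2 l (f x y)) =
    sg2 l (fun a b => sg1 h (fun x y => f x y a b))) ->
  sweedler_like sg_prod.
Proof.
move=> sg1P sg2P exch; split=> [V h f g fg|V h f|V h f]; rewrite /sg_prod /=.
- by apply: (sgE sg1P) => x y; apply: (sgE sg2P) => x' y'.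
- by rewrite (sgC sg1P); apply: (sgE sg1P) => x y; rewrite (sgC sg2P).
under (sgE sg1P) => x y do rewrite -exch.
under [RHS](sgE sg1P) => x y do rewrite -exch.
rewrite (sgA sg1P h.1 (fun p q y => sg2 h.2 (fun a b =>
    sg2 a (fun x' y' => f (p, x') (q, y') (y, b))))).
by apply: (sgE sg1P) => x y; apply: (sgE sg1P) => p q; rewrite (sgA sg2P).
Qed.

End ProductReordering.

(** * Counit, antipode and multiplicativity rules for Sweedler sums *)

Section Hopf.
Context {k : fieldType} {H : falgType k}.
Variables (Delta : H -> 'M[k]_(@dimH k H)) (eps : H -> k) (S : H -> H).
Hypothesis hopfH : is_hopf Delta eps S.
Hypothesis cocomm : cocommutative Delta.
Implicit Types (V W : lmodType k) (h l : H).

Local Notation sD := (fun V h (f : H -> H -> V) => sw (Delta h) f).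

Lemma Delta_lin : lin Delta. Proof. by case: hopfH => -[]. Qed.
Lemma eps_lin : lin (eps : H -> k^o). Proof. by case: hopfH => -[_ []]. Qed.
Lemma S_lin : lin S. Proof. by case: hopfH => -[_ []]. Qed.

Lemma swC V h (f : H -> H -> V) : sw (Delta h) f = sw (Delta h) (fun x y => f y x).
Proof.
rewrite /sw exchange_big; apply: eq_bigr => i _; apply: eq_bigr => j _.
by rewrite -{1}(cocomm h) mxE.
Qed.

(** Collecting the coefficient of [f (bas p) (bas q) (bas r)] on each side leaves exactly the
    coordinate form of coassociativity. *)
Lemma swA V h (f : H -> H -> H -> V) :
  sw (Delta h) (fun x y => sw (Delta x) (fun p q => f p q y))
  = sw (Delta h) (fun x y => sw (Delta y) (fun q r => f x q r)).
Proof.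
have coassoc := let: And5 _ ca _ _ _ := hopfH in ca.
rewrite /sw; under eq_bigr => i _ do under eq_bigr => j _ do rewrite scaler_sumr.
under eq_bigr => i _ do rewrite exchange_big.
rewrite exchange_big; apply: eq_bigr => p _.
under eq_bigr => i _ do under eq_bigr => j _ do rewrite scaler_sumr.
under [RHS]eq_bigr => i _ do rewrite scaler_sumr.
under eq_bigr => i _ do rewrite exchange_big.
rewrite exchange_big [RHS]exchange_big; apply: eq_bigr => q _.
under [RHS]eq_bigr => i _ do rewrite scaler_sumr.
rewrite exchange_big [RHS]exchange_big; apply: eq_bigr => r _.
under eq_bigr => i _ do rewrite scalerA.
under [RHS]eq_bigr => i _ do rewrite scalerA.
by rewrite -!scaler_suml coassoc.
Qed.

Lemma sw_sweedler : sweedler_like sD.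
Proof. by split=> *; [exact: eq_sw | exact: swC | exact: swA]. Qed.

Definition swAC := @sgAC _ _ _ sw_sweedler.
Definition swACA := @sgACA _ _ _ sw_sweedler.

Definition sw2 := sg_prod sD sD.
Definition sw3 := sg_prod sw2 sD.

Lemma sw2_sweedler : sweedler_like sw2.
Proof. by apply: sg_prod_sweedler sw_sweedler sw_sweedler _ => *; exact: sw_exch. Qed.

Lemma sw3_sweedler : sweedler_like sw3.
Proof.
apply: sg_prod_sweedler sw2_sweedler sw_sweedler _ => V h l f.
by rewrite /sw2 /sg_prod [RHS]sw_exch; apply: eq_sw => x y; exact: sw_exch.
Qed.

Definition sw2CAA := @sgCAA _ _ _ sw2_sweedler.

Lemma sw_lin V (f : H -> H -> V) : lin (fun h => sw (Delta h) f).
Proof. exact: (lin_comp (sw_lin_mx f) Delta_lin). Qed.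

Lemma sw_eps V h (f : H -> V) : lin f -> sw (Delta h) (fun x y => eps x *: f y) = f h.
Proof.
move=> fL; have [_ _ [epsl _] _ _] := hopfH.
rewrite -{2}(epsl h) lin_sw //.
by apply: eq_sw => x y; rewrite linZ.
Qed.

Lemma sw_eps_r V h (f : H -> V) : lin f -> sw (Delta h) (fun x y => eps y *: f x) = f h.
Proof. by move=> fL; rewrite swC sw_eps. Qed.

Lemma sw1 V (f : H -> H -> V) : bilin f -> sw (Delta 1) f = f 1 1.
Proof. by move=> fB; case: hopfH => _ _ _ [-> _ _ _] _; rewrite sw_tens. Qed.

Lemma swM V h l (f : H -> H -> V) : bilin f ->
  sw (Delta (h * l)) f
  = sw (Delta h) (fun x y => sw (Delta l) (fun x' y' => f (x * x') (y * y'))).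
Proof.
move=> fB; case: hopfH => _ _ _ [_ -> _ _] _.
rewrite (lin_sw _ _ (sw_lin_mx f)); apply: eq_sw => x y.
rewrite (lin_sw _ _ (sw_lin_mx f)); apply: eq_sw => x' y'.
exact: sw_tens.
Qed.

Lemma swSl V h (f : H -> V) : lin f ->
  sw (Delta h) (fun x y => f (S x * y)) = eps h *: f 1.
Proof. by move=> fL; rewrite -lin_sw // -linZ //; case: hopfH => _ _ _ _ [-> _]. Qed.

Lemma swSr V h (f : H -> V) : lin f ->
  sw (Delta h) (fun x y => f (x * S y)) = eps h *: f 1.
Proof. by move=> fL; rewrite -lin_sw // -linZ //; case: hopfH => _ _ _ _ [_ ->]. Qed.

(* Both sides are convolution inverses of [Delta]: evaluate
   [(S h_1)_1 h_2 S(h_4) (x) (S h_1)_2 h_3 S(h_5)] in two ways. *)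
Lemma swS V h (f : H -> H -> V) : bilin f ->
  sw (Delta (S h)) f = sw (Delta h) (fun x y => f (S x) (S y)).
Proof.
move=> [fL fR].
have fB a b : bilin (fun x y => f (x * S a) (y * S b)).
  split=> z; [apply: (lin_comp (fL _)) | apply: (lin_comp (fR _))];
    exact: lin_mull (@lin_id _ _).
rewrite -(sw_eps h (f := fun q => sw (Delta q) (fun a b => f (S a) (S b))));
  last exact: sw_lin.
transitivity (sw (Delta h) (fun p q => sw (Delta q) (fun a b =>
    sw (Delta p) (fun p1 p2 => sw (Delta (S p1)) (fun x y =>
      sw (Delta p2) (fun z w => f (x * z * S a) (y * w * S b))))))); last first.
  apply: eq_sw => p q; rewrite swZ; apply: eq_sw => a b.
  under eq_sw => p1 p2 do rewrite -(swM _ _ (fB a b)).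
  by rewrite (swSl p (sw_lin (fun x y => f (x * S a) (y * S b)))) sw1 // !mul1r.
under [RHS]eq_sw => p q do rewrite sw_exch.
rewrite (swA h (fun p1 p2 q => sw (Delta q) (fun a b =>
    sw (Delta (S p1)) (fun x y =>
      sw (Delta p2) (fun z w => f (x * z * S a) (y * w * S b)))))).
rewrite -[LHS](sw_eps_r h (f := fun h => sw (Delta (S h)) f)); last first.
  exact: (lin_comp (sw_lin f) S_lin).
apply: eq_sw => p1 r.
transitivity (sw (Delta (S p1)) (fun x y => sw (Delta r) (fun p q =>
    sw (Delta p) (fun z w => sw (Delta q) (fun a b =>
      f (x * (z * S a)) (y * (w * S b))))))); last first.
  rewrite sw_exch; apply: eq_sw => p q; rewrite [RHS]sw_exch.
  apply: eq_sw => x y; rewrite sw_exch.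
  by apply: eq_sw => z w; apply: eq_sw => a b; rewrite !mulrA.
rewrite swZ; apply: eq_sw => x y.
rewrite swACA.
have fxL (y' : H) : lin (fun z => f (x * z) y')
  by exact: (lin_comp (fR _) (lin_mulr x (@lin_id _ H))).
have fyL (x' : H) : lin (fun w => f x' (y * w))
  by exact: (lin_comp (fL _) (lin_mulr y (@lin_id _ H))).
under eq_sw => p q.
  under eq_sw => z a do rewrite (swSr q (fyL _)) mulr1.
  rewrite (swSr p (lin_scale (eps q) (fxL y))) mulr1.
  over.
by rewrite (sw_eps r (f := fun q => eps q *: f x y)) //; exact: lin_scalel eps_lin.
Qed.

End Hopf.

(** * The axioms of a symmetric twisted partial action *)

Section CrossedProduct.
Context {k : fieldType} {H : falgType k} {A : algType k}.
Variables (Delta : H -> 'M[k]_(@dimH k H)) (eps : H -> k) (S : H -> H).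
Variables (act : H -> A -> A) (omega omega' : H -> H -> A).
Hypothesis hopfH : is_hopf Delta eps S.
Hypothesis cocomm : cocommutative Delta.
Hypothesis symA : symmetric_tpa Delta eps act omega omega'.

Local Notation AH := (@AH k H A).
Local Notation swS := (swS hopfH cocomm).
Local Notation swA := (swA hopfH).
Local Notation sw2 := (sw2 Delta).
Local Notation sw3 := (sw3 Delta).
Local Notation "X ** Y" := (cpmul Delta act omega X Y) (at level 40, left associativity).
Local Notation cp := (cp Delta act).
Implicit Types (h l m : H) (a b : A) (X Y Z : AH).

Lemma act_linl a : lin (fun h => act h a).
Proof. by case: symA => -[[[[E _] _]]]. Qed.
Lemma act_linr h : lin (act h).
Proof. by case: symA => -[[[[_ E] _]]]. Qed.
Lemma omega_bilin : bilin omega.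
Proof. by case: symA => -[[[_ E]]]. Qed.
Lemma act1 a : act 1 a = a.
Proof. by case: symA => -[[_ ->]]. Qed.
Lemma actM h a b : act h (a * b) = sw (Delta h) (fun x y => act x a * act y b).
Proof. by case: symA => -[[_ _ ->]]. Qed.
Lemma actT3 : T3 Delta act omega.
Proof. by case: symA => _ _ [_ []]. Qed.
Lemma omega_f2 h l : omega h l =
  sw (Delta h) (fun x y => sw (Delta l) (fun x' y' => omega x x' * act (y * y') 1)).
Proof. by case: symA => -[[_ _ _ _ E]]. Qed.
Lemma omegaC : C_cond Delta act omega.
Proof. by case: symA => _ _ [_ [_ E]]. Qed.
Lemma omega1l h : omega 1 h = act h 1.
Proof. by case: symA => _ _ [E]; case: (E h). Qed.
Lemma omega1r h : omega h 1 = act h 1.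
Proof. by case: symA => _ _ [E]; case: (E h). Qed.
Lemma omega'_bilin : bilin omega'.
Proof. by case: symA => _ _ _ []. Qed.
Lemma omega_omega' : conv2 Delta omega omega' = conv2 Delta (f1_map eps act) (f2_map act).
Proof. by case: symA => _ _ _ [_ []]. Qed.
Lemma act_act1 h l : act h (act l 1) = sw (Delta h) (fun x y => act x 1 * act (y * l) 1).
Proof. by case: symA => _ _ _ _ ->. Qed.

(** * Left multiplications in A (x) H *)

Definition lact a X : AH := [ffun i => a * X i].
(** This element need not lie in A#H; [lmul 1] sends it to [cp 1 h]. *)
Definition gam h : AH := atens 1 h.

Lemma lact_linr a : lin (lact a).
Proof. by move=> c X Y; apply/ffunP=> i; rewrite !ffunE mulrDr scalerAr. Qed.
Lemma lact_linl X : lin (fun a => lact a X).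
Proof. by move=> c a b; apply/ffunP=> i; rewrite !ffunE mulrDl scalerAl. Qed.
Lemma lactA a b X : lact a (lact b X) = lact (a * b) X.
Proof. by apply/ffunP=> i; rewrite !ffunE mulrA. Qed.
Lemma lact1 X : lact 1 X = X.
Proof. by apply/ffunP=> i; rewrite !ffunE mul1r. Qed.
Lemma gam_lin : lin gam.
Proof. by move=> c u v; apply/ffunP=> i; rewrite !ffunE linearP scalerDl scalerA. Qed.
Lemma atensE a h : atens a h = lact a (gam h).
Proof. by apply/ffunP=> i; rewrite !ffunE -scalerAr mulr1. Qed.

Lemma AH_expand X : X = \sum_j lact (X j) (gam (bas j)).
Proof.
apply/ffunP=> i; rewrite sum_ffunE (bigD1 i) //= big1 ?addr0 => [|j ne].
  by rewrite !ffunE coord_bas eqxx scale1r mulr1.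
by rewrite !ffunE coord_bas eq_sym (negPf ne) scale0r mulr0.
Qed.

(* [gamgam h l] and [lmul h Y] are the products [(1 (x) h)(1 (x) l)] and
   [(1 (x) h) Y] of [A (x) H], which is associative but in general not unital:
   [1 (x) 1] is an idempotent and [A#H] is the set of [X] with [lmul 1 X = X]. *)
Definition gamgam h l : AH :=
  sw (Delta h) (fun x y => sw (Delta l) (fun x' y' => lact (omega x x') (gam (y * y')))).

Lemma gamgam_bilin : bilin gamgam.
Proof.
split=> [h|l]; rewrite /gamgam; last exact: (sw_lin hopfH).
by apply: sw_lin_arg => x y; exact: (sw_lin hopfH).
Qed.

Definition lmul h Y : AH := \sum_j sw (Delta h) (fun x y => lact (act x (Y j)) (gamgam y (bas j))).

(** The product is left A-linear in [X], so all its properties reduce to those of the operators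
    [lmul]. *)
Lemma cpmulE X Y : X ** Y = \sum_i lact (X i) (lmul (bas i) Y).
Proof.
apply: eq_bigr => i _; rewrite (lin_sum _ _ _ (lact_linr _)); apply: eq_bigr => j _.
rewrite /cpmul_el (lin_sw _ _ (lact_linr _)); apply: eq_sw => h1 h23.
rewrite lactA (lin_sw _ _ (lact_linr _)); apply: eq_sw => h2 h3.
rewrite (lin_sw _ _ (lact_linr _)); apply: eq_sw => l1 l2.
by rewrite lactA atensE.
Qed.

Lemma lmul_linr h : lin (lmul h).
Proof.
apply: lin_bigsum => j; apply: sw_lin_arg => x y.
apply: (lin_comp (lact_linl _)); apply: (lin_comp (act_linr _)) => c X Y.
by rewrite !ffunE.
Qed.

Lemma lmul_linl Y : lin (fun h => lmul h Y).
Proof. by apply: lin_bigsum => j; exact: (sw_lin hopfH). Qed.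

Lemma lmul_lact h a Y : lmul h (lact a Y) = sw (Delta h) (fun x y => lact (act x a) (lmul y Y)).
Proof.
rewrite /lmul.
under [RHS]eq_sw => x y do rewrite (lin_sum _ _ _ (lact_linr _)).
rewrite sw_sum.
apply: eq_bigr => j _; under [RHS]eq_sw => x y do rewrite (lin_sw _ _ (lact_linr _)).
rewrite -swA; apply: eq_sw => x y; rewrite ffunE actM (lin_sw _ _ (lact_linl _)).
by apply: eq_sw => p q; rewrite lactA.
Qed.

(** Condition (T3) at the unit of A turns right absorption by [omega] into left absorption. *)
Lemma omega_f1f2 h l :
  omega h l = sw (Delta h) (fun x y => sw (Delta l) (fun x' y' =>
                act x (act x' 1) * omega y y')).
Proof. by rewrite omega_f2 actT3. Qed.

(** By [omega_f1f2], [omega] carries a left factor h1 . (l1 . 1), and any h . a absorbs e on the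
    left because h . (1 a) = h . a. *)
Lemma e_omega h l : sw (Delta h) (fun x y => act x 1 * omega y l) = omega h l.
Proof.
under eq_sw => x y.
  rewrite omega_f1f2 (lin_sw _ _ (lin_mulr _ (@lin_id _ _))).
  under eq_sw => p q.
    rewrite (lin_sw _ _ (lin_mulr _ (@lin_id _ _))).
    under eq_sw => r s do rewrite mulrA.
    over.
  over.
rewrite -(swA h (fun x p q => sw (Delta l) (fun r s =>
   act x 1 * act p (act r 1) * omega q s))) omega_f1f2.
apply: eq_sw => y q; rewrite sw_exch; apply: eq_sw => r s.
by rewrite -(lin_sw _ _ (lin_mull _ (@lin_id _ _))) -actM mul1r.
Qed.

Lemma gamgam_e h l : sw (Delta h) (fun x y => lact (act x 1) (gamgam y l)) = gamgam h l.
Proof.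
under eq_sw => x y.
  rewrite (lin_sw _ _ (lact_linr _)).
  under eq_sw => p q.
    rewrite (lin_sw _ _ (lact_linr _)).
    under eq_sw => r s do rewrite lactA.
    over.
  over.
rewrite -(swA h (fun x p q => sw (Delta l) (fun r s =>
   lact (act x 1 * omega p r) (gam (q * s))))).
apply: eq_sw => y q; rewrite sw_exch; apply: eq_sw => r s.
by rewrite -(lin_sw _ _ (lact_linl _)) e_omega.
Qed.

(** Unfolding [lmul] at 1 (x) l leaves an extra factor h1 . 1, which [gamgam_e] absorbs. *)
Lemma lmul_gam h l : lmul h (gam l) = gamgam h l.
Proof.
rewrite -gamgam_e /lmul -sw_sum; apply: eq_sw => x y.
rewrite (lin_bas l (bilin2 y gamgam_bilin)) (lin_sum _ _ _ (lact_linr _)).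
apply: eq_bigr => j _; rewrite ffunE (linZ (act_linr _)) (linZ (lact_linl _)).
by rewrite (linZ (lact_linr _)).
Qed.

Lemma lmul_lact_gam h a l :
  lmul h (lact a (gam l)) = sw (Delta h) (fun x y => lact (act x a) (gamgam y l)).
Proof. by rewrite lmul_lact; apply: eq_sw => x y; rewrite lmul_gam. Qed.

(** * Associativity of the product of A (x) H *)

Lemma gamgam_mulr p h l : gamgam p (h * l) =
  sw (Delta p) (fun x y => sw2 (h, l) (fun u v =>
    lact (omega x (u.1 * u.2)) (gam (y * (v.1 * v.2))))).
Proof.
apply: eq_sw => x y; rewrite (swM hopfH) //; split=> z.
  apply: lin_comp (lact_linr _) _; apply: (lin_comp gam_lin); exact: lin_mulr.
by apply: lin_comp (lact_linl _) _; exact: bilin2 omega_bilin.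
Qed.

Lemma gamgam_mull h l m : gamgam (h * l) m =
  sw2 (h, l) (fun u v => sw (Delta m) (fun x y =>
    lact (omega (u.1 * u.2) x) (gam (v.1 * v.2 * y)))).
Proof.
rewrite /gamgam (swM hopfH) //; split=> z; apply: sw_lin_arg => p q.
  apply: lin_comp (lact_linr _) _; apply: (lin_comp gam_lin); exact: lin_mull.
by apply: lin_comp (lact_linl _) _; exact: bilin1 omega_bilin.
Qed.

(** Associativity on three elements of the form 1 (x) h, which is the cocycle condition (C) written
    inside A (x) H. *)
Lemma lmul_gamgam h l m :
  lmul h (gamgam l m) = sw2 (h, l) (fun u v => lact (omega u.1 u.2) (gamgam (v.1 * v.2) m)).
Proof.
rewrite (lin_sw _ _ (lmul_linr _)).
transitivity (sw3 (h, l, m) (fun u v => sw3 v (fun p q =>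
   lact (act u.1.1 (omega u.1.2 u.2) * omega p.1.1 (p.1.2 * p.2))
      (gam (q.1.1 * (q.1.2 * q.2)))))).
  rewrite /sw3 /sw2 /sg_prod /= [RHS]sw_exch; apply: eq_sw => x y.
  rewrite (lin_sw _ _ (lmul_linr _)) [RHS]sw_exch; apply: eq_sw => x' y'.
  rewrite lmul_lact_gam; apply: eq_sw => x'' y''.
  rewrite gamgam_mulr (lin_sw _ _ (lact_linr _)); apply: eq_sw => p q.
  rewrite /sw2 /sg_prod /=.
  rewrite (lin_sw _ _ (lact_linr _)); apply: eq_sw => p' q'.
  rewrite (lin_sw _ _ (lact_linr _)); apply: eq_sw => p'' q''.
  by rewrite lactA.
(* Regrouping places both [omega] factors over the coproduct of the single triple [u], where they
   form the left side of (C). *)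
rewrite -(sgA (sw3_sweedler hopfH cocomm)).
transitivity (sw3 (h, l, m) (fun u v => sw2 u.1 (fun p q =>
   lact (omega p.1 p.2 * omega (q.1 * q.2) u.2) (gam (v.1.1 * (v.1.2 * v.2)))))).
  apply: (sgE (sw3_sweedler hopfH cocomm)) => -[[u u'] u''] [[v v'] v''] /=.
  rewrite /sw3 /sw2 /sg_prod /=; set Z := gam _.
  transitivity (lact (sw (Delta u) (fun x y => sw (Delta u') (fun x' y' =>
    sw (Delta u'') (fun x'' y'' => act x (omega x' x'') * omega y (y' * y''))))) Z).
    rewrite (lin_sw _ _ (lact_linl Z)); apply: eq_sw => x y.
    rewrite (lin_sw _ _ (lact_linl Z)); apply: eq_sw => x' y'.
    by rewrite (lin_sw _ _ (lact_linl Z)).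
  rewrite omegaC (lin_sw _ _ (lact_linl Z)); apply: eq_sw => x y.
  by rewrite (lin_sw _ _ (lact_linl Z)); apply: eq_sw.
(* The right side of (C) keeps its third argument undivided, so the sum over [m] separates from
   those over [h] and [l]. *)
transitivity (sw2 (h, l) (fun w v => sw2 w (fun p q => sw (Delta m) (fun u'' v'' =>
   lact (omega p.1 p.2 * omega (q.1 * q.2) u'') (gam (v.1 * (v.2 * v'')))))) ).
  apply: (sgE (sw2_sweedler hopfH cocomm)) => -[u u'] [v v'] /=.
  rewrite /sw2 /sg_prod /= sw_exch; apply: eq_sw => x y.
  by rewrite sw_exch.
rewrite (sgA (sw2_sweedler hopfH cocomm) _ (fun p q v => sw (Delta m) (fun u'' v'' =>
   lact (omega p.1 p.2 * omega (q.1 * q.2) u'') (gam (v.1 * (v.2 * v'')))))).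
apply: (sgE (sw2_sweedler hopfH cocomm)) => -[u u'] [v v'] /=.
rewrite gamgam_mull /sw2 /sg_prod (lin_sw _ _ (lact_linr _)); apply: eq_sw => p q.
rewrite (lin_sw _ _ (lact_linr _)); apply: eq_sw => p' q'.
rewrite (lin_sw _ _ (lact_linr _)); apply: eq_sw => p'' q''.
by rewrite lactA mulrA.
Qed.

(** By linearity [Y] may be taken as a (x) m. Then [lmul_gamgam] handles the product with [m], and
    (T3) replaces (h1 . (l1 . a)) omega(h2, l2) by omega(h1, l1) (h2 l2 . a). *)
Lemma lmul_lmul h l Y :
  lmul h (lmul l Y) = sw2 (h, l) (fun u v => lact (omega u.1 u.2) (lmul (v.1 * v.2) Y)).
Proof.
pose R Y := sw2 (h, l) (fun u v => lact (omega u.1 u.2) (lmul (v.1 * v.2) Y)).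
have RL : lin R.
  apply: sw_lin_arg => x y; apply: sw_lin_arg => x' y'.
  exact: (lin_comp (lact_linr _) (lmul_linr _)).
rewrite -/(R Y) (AH_expand Y) (lin_sum _ _ _ RL).
rewrite (lin_sum _ _ _ (lmul_linr l)) (lin_sum _ _ _ (lmul_linr h)).
apply: eq_bigr => j _; move: (Y j) (bas j) => a m.
have swE2 := sgE (sw2_sweedler hopfH cocomm).
rewrite lmul_lact_gam (lin_sw _ _ (lmul_linr _)).
transitivity (sw2 (h, l) (fun u v => sw2 v (fun p q =>
    lact (act u.1 (act u.2 a) * omega p.1 p.2) (gamgam (q.1 * q.2) m)))).
  rewrite /sw2 /sg_prod /= [RHS]sw_exch; apply: eq_sw => x' y'.
  rewrite lmul_lact; apply: eq_sw => x y; rewrite lmul_gamgam /sw2 /sg_prod.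
  rewrite (lin_sw _ _ (lact_linr _)); apply: eq_sw => p q.
  rewrite (lin_sw _ _ (lact_linr _)); apply: eq_sw => p' q'.
  by rewrite lactA.
rewrite -(sgA (sw2_sweedler hopfH cocomm) _ (fun u p q =>
    lact (act u.1 (act u.2 a) * omega p.1 p.2) (gamgam (q.1 * q.2) m))).
transitivity (sw2 (h, l) (fun u q => sw2 u (fun v p =>
    lact (omega v.1 v.2 * act (p.1 * p.2) a) (gamgam (q.1 * q.2) m)))).
  apply: (swE2) => -[u u'] q; rewrite /sw2 /sg_prod /=; set Z := gamgam _ _.
  transitivity (lact (sw (Delta u) (fun x y => sw (Delta u') (fun x' y' =>
     act x (act x' a) * omega y y'))) Z).
    rewrite (lin_sw _ _ (lact_linl Z)); apply: eq_sw => x y.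
    by rewrite (lin_sw _ _ (lact_linl Z)).
  rewrite actT3 (lin_sw _ _ (lact_linl Z)); apply: eq_sw => x y.
  by rewrite (lin_sw _ _ (lact_linl Z)).
rewrite (sgA (sw2_sweedler hopfH cocomm) _ (fun v p q =>
    lact (omega v.1 v.2 * act (p.1 * p.2) a) (gamgam (q.1 * q.2) m))).
apply: (swE2) => u [v v']; rewrite lmul_lact_gam (swM hopfH) /=; last first.
  split=> z; [exact: lin_comp (lact_linr _) (bilin1 _ gamgam_bilin)|].
  exact: lin_comp (lact_linl _) (act_linl _).
rewrite (lin_sw _ _ (lact_linr _)); apply: eq_sw => p q.
rewrite (lin_sw _ _ (lact_linr _)); apply: eq_sw => p' q'.
by rewrite lactA.
Qed.

Lemma cpmul_lact a X Y : lact a X ** Y = lact a (X ** Y).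
Proof.
rewrite !cpmulE (lin_sum _ _ _ (lact_linr _)); apply: eq_bigr => i _.
by rewrite ffunE lactA.
Qed.

Lemma cpmul_linl Y : lin (fun X => X ** Y).
Proof.
move=> c X Z; rewrite !cpmulE scaler_sumr -big_split; apply: eq_bigr => i _ /=.
by rewrite !ffunE lact_linl.
Qed.

Lemma cpmul_linr X : lin (fun Y => X ** Y).
Proof.
move=> c Y Z; rewrite !cpmulE scaler_sumr -big_split; apply: eq_bigr => i _ /=.
by rewrite lmul_linr lact_linr.
Qed.

Lemma cpmul_gam h Y : gam h ** Y = lmul h Y.
Proof.
rewrite cpmulE (lin_bas h (lmul_linl Y)); apply: eq_bigr => i _.
by rewrite ffunE (linZ (lact_linl _)) lact1.
Qed.

(** Left A-linearity reduces [X] to 1 (x) h. Expanding the middle factor in the same way reduces the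
    claim to [lmul_lmul]. *)
Lemma cpmulA X Y Z : X ** (Y ** Z) = X ** Y ** Z.
Proof.
have LM h W : lmul h (W ** Z) = lmul h W ** Z.
  rewrite (AH_expand W) (lin_sum _ _ _ (cpmul_linl Z)) !(lin_sum _ _ _ (lmul_linr h)).
  rewrite (lin_sum _ _ _ (cpmul_linl Z)).
  apply: eq_bigr => j _; rewrite cpmul_lact cpmul_gam lmul_lact lmul_lact_gam.
  rewrite (lin_sw _ _ (cpmul_linl Z)); apply: eq_sw => x y.
  rewrite cpmul_lact lmul_lmul (lin_sw _ _ (cpmul_linl Z)).
  congr lact; apply: eq_sw => p q; rewrite (lin_sw _ _ (cpmul_linl Z)).
  by apply: eq_sw => p' q'; rewrite cpmul_lact cpmul_gam.
rewrite (AH_expand X) (lin_sum _ _ _ (cpmul_linl (Y ** Z))).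
rewrite (lin_sum _ _ _ (cpmul_linl Y)) (lin_sum _ _ _ (cpmul_linl Z)).
by apply: eq_bigr => i _; rewrite !cpmul_lact !cpmul_gam LM.
Qed.

(** * The unital algebra A#H inside A (x) H *)

Local Notation Gam h := (cp 1 h).
Local Notation al a := (cp a 1).

Lemma cpE a h : cp a h = lact a (Gam h).
Proof.
rewrite /cp (lin_sw _ _ (lact_linr a)); apply: eq_sw => x y.
by rewrite !atensE lactA mul1r.
Qed.

Lemma GamE h : Gam h = sw (Delta h) (fun x y => lact (act x 1) (gam y)).
Proof. by apply: eq_sw => x y; rewrite atensE mul1r. Qed.

Lemma Gam_lin : lin (fun h => Gam h).
Proof. exact: (sw_lin hopfH). Qed.

Lemma Gam1 : Gam 1 = gam 1.
Proof.
rewrite GamE (sw1 hopfH) ?act1 ?lact1 //; split=> z; first exact: lin_comp (lact_linr _) gam_lin.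
exact: lin_comp (lact_linl _) (act_linl _).
Qed.

Lemma alE a : al a = lact a (gam 1).
Proof. by rewrite cpE Gam1. Qed.

Lemma al_lin : lin (fun a => al a).
Proof. by move=> c a b; rewrite !alE lact_linl. Qed.

Lemma lmul1_lact a Y : lmul 1 (lact a Y) = lact a (lmul 1 Y).
Proof.
rewrite lmul_lact (sw1 hopfH) ?act1 //; split=> z.
  exact: lin_comp (lact_linr _) (lmul_linl _).
exact: lin_comp (lact_linl _) (act_linl _).
Qed.

(** The normalisation omega(1, l) = l . 1 is what makes left multiplication by 1 (x) 1 the
    projection onto A#H. *)
Lemma lmul1_gam l : lmul 1 (gam l) = Gam l.
Proof.
rewrite lmul_gam /gamgam (sw1 hopfH); last first.
  split=> z; apply: sw_lin_arg => x y.
    by apply: (lin_comp (lact_linr _)); apply: (lin_comp gam_lin); exact: lin_mull.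
  by apply: lin_comp (lact_linl _) _; exact: bilin1 omega_bilin.
by rewrite GamE; apply: eq_sw => x y; rewrite omega1l mul1r.
Qed.

Lemma lmul1_expand Y : lmul 1 Y = \sum_j cp (Y j) (bas j).
Proof.
rewrite {1}(AH_expand Y) (lin_sum _ _ _ (lmul_linr 1)); apply: eq_bigr => j _.
by rewrite lmul1_lact lmul1_gam -cpE.
Qed.

Lemma lmul1_idem Y : lmul 1 (lmul 1 Y) = lmul 1 Y.
Proof. by rewrite -!cpmul_gam cpmulA cpmul_gam lmul1_gam Gam1. Qed.

(** Replaces membership in a span by a linear fixed-point equation, which passes directly through
    sums and products. *)
Lemma in_cpP X : in_cp Delta act X <-> lmul 1 X = X.
Proof.
split=> [[s ->]|<-].
  rewrite (lin_sum _ _ _ (lmul_linr 1)); apply: eq_bigr => p _.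
  by rewrite cpE lmul1_lact -lmul1_gam lmul1_idem.
exists [seq (X j, bas j) | j : 'I_dimH].
by rewrite big_map big_enum lmul1_expand.
Qed.

Lemma in_cp_cp a h : in_cp Delta act (cp a h).
Proof. by exists [:: (a, h)]; rewrite big_seq1. Qed.

Lemma in_cpM X Y : in_cp Delta act X -> in_cp Delta act (X ** Y).
Proof. by move=> /in_cpP XE; apply/in_cpP; rewrite -cpmul_gam cpmulA cpmul_gam XE. Qed.

Lemma in_cpL c X Y : in_cp Delta act X -> in_cp Delta act Y -> in_cp Delta act (c *: X + Y).
Proof. by move=> /in_cpP XE /in_cpP YE; apply/in_cpP; rewrite lmul_linr XE YE. Qed.

Lemma in_cp_sw D (F : H -> H -> AH) : (forall x y, in_cp Delta act (F x y)) ->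
  in_cp Delta act (sw D F).
Proof.
move=> FP; apply/in_cpP; rewrite (lin_sw _ _ (lmul_linr 1)); apply: eq_sw => x y.
exact/in_cpP.
Qed.

(** [Gam h] is the product of 1 (x) 1 and 1 (x) h. The left factor only contributes omega(1, h1) =
    h1 . 1, and [lmul] already absorbs this. *)
Lemma Gam_mul h Y : Gam h ** Y = lmul h Y.
Proof.
rewrite -lmul1_gam -!cpmul_gam -cpmulA !cpmul_gam lmul_lmul /sw2 /sg_prod /= (sw1 hopfH).
  rewrite -{2}(lact1 Y) lmul_lact; apply: eq_sw => x y.
  by rewrite omega1l mul1r.
split=> z; apply: sw_lin_arg => x y.
  by apply: (lin_comp (lact_linr _)); apply: (lin_comp (lmul_linl _)); exact: lin_mull.
by apply: lin_comp (lact_linl _) _; exact: bilin1 omega_bilin.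
Qed.

Lemma al_mul a Y : al a ** Y = lact a (lmul 1 Y).
Proof. by rewrite alE cpmul_lact cpmul_gam. Qed.

Lemma al_mul_cp a Y : in_cp Delta act Y -> al a ** Y = lact a Y.
Proof. by rewrite al_mul => /in_cpP ->. Qed.

Lemma alM a b : al a ** al b = al (a * b).
Proof. by rewrite al_mul_cp ?alE ?lactA // -alE; exact: in_cp_cp. Qed.

Lemma gamgam1 h : gamgam h 1 = Gam h.
Proof.
rewrite GamE; apply: eq_sw => p q; rewrite (sw1 hopfH) ?omega1r ?mulr1 //.
split=> z; first by apply: (lin_comp (lact_linr _)); apply: (lin_comp gam_lin); exact: lin_mulr.
by apply: lin_comp (lact_linl _) _; exact: bilin2 omega_bilin.
Qed.

Lemma Gam_al h a : Gam h ** al a = sw (Delta h) (fun x y => lact (act x a) (Gam y)).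
Proof. by rewrite Gam_mul alE lmul_lact_gam; apply: eq_sw => x y; rewrite gamgam1. Qed.

Lemma Gam_Gam h l : Gam h ** Gam l = gamgam h l.
Proof.
rewrite Gam_mul -lmul1_gam lmul_lmul -gamgam_e; apply: eq_sw => x y /=; rewrite (sw1 hopfH).
  by rewrite omega1r mulr1 lmul_gam.
split=> z.
  by apply: (lin_comp (lact_linr _)); apply: (lin_comp (lmul_linl _)); exact: lin_mulr.
by apply: lin_comp (lact_linl _) _; exact: bilin2 omega_bilin.
Qed.

(** The product lies in A#H, hence is fixed by [lmul 1]; applying this projection termwise turns
    every [gam] into [Gam]. *)
Lemma gamgamE h l : gamgam h l = sw2 (h, l) (fun u v => lact (omega u.1 u.2) (Gam (v.1 * v.2))).
Proof.
have := in_cpM (Gam l) (in_cp_cp 1 h); rewrite Gam_Gam => /in_cpP <-.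
rewrite (lin_sw _ _ (lmul_linr 1)); apply: eq_sw => x y.
by rewrite (lin_sw _ _ (lmul_linr 1)); apply: eq_sw => p q; rewrite lmul1_lact lmul1_gam.
Qed.

(** Convolution centrality of e, tested against the map h |-> eps(h) a, gives centrality of each
    value in A. *)
Lemma act_central h a : act h 1 * a = a * act h 1.
Proof.
have aL : lin (fun h => eps h *: a) by exact: lin_scalel (eps_lin hopfH).
have : central_Hom Delta (e_map act) by case: symA => -[].
move=> /(_ _ aL) /(congr1 (fun f => f h)); rewrite /conv /e_map => E.
transitivity (sw (Delta h) (fun x y => act x 1 * (eps y *: a))).
  rewrite -(sw_eps_r hopfH cocomm h (f := fun h => act h 1 * a)).
    by apply: eq_sw => x y /=; rewrite scalerAr.
  exact: lin_mull (act_linl 1).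
rewrite E -(sw_eps hopfH h (f := fun h => a * act h 1)).
  by apply: eq_sw => x y /=; rewrite scalerAl.
exact: lin_mulr (act_linl 1).
Qed.

Lemma Gam_e h : sw (Delta h) (fun x y => lact (act x 1) (Gam y)) = Gam h.
Proof. by rewrite -Gam_al Gam_Gam gamgam1. Qed.

Lemma e_e h : sw (Delta h) (fun x y => act x 1 * act y 1) = act h 1.
Proof. by rewrite -actM mulr1. Qed.

(** The symmetry axiom splits h . (l . 1) as (h1 . 1)(h2 l . 1); the factor h1 . 1 is central and
    disappears into [Gam] by [Gam_e]. *)
Lemma Gam_al_act h l :
  Gam h ** al (act l 1) = sw (Delta h) (fun x y => lact (act (x * l) 1) (Gam y)).
Proof.
rewrite Gam_al.
transitivity (sw (Delta h) (fun x y => sw (Delta x) (fun q p =>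
    lact (act (q * l) 1 * act p 1) (Gam y)))).
  apply: eq_sw => x y; rewrite act_act1 (lin_sw _ _ (lact_linl _)) (swC cocomm).
  by apply: eq_sw => q p; rewrite act_central.
rewrite (swA h (fun q p y => lact (act (q * l) 1 * act p 1) (Gam y))).
apply: eq_sw => x y; rewrite -[in RHS]Gam_e (lin_sw _ _ (lact_linr _)).
by apply: eq_sw => p q; rewrite lactA.
Qed.

(** * A convolution inverse of [Gam] up to e *)

Definition omegaS h : A := sw (Delta h) (fun x y => omega x (S y)).
(** Right convolution inverse of [omegaS] up to e. It corrects the factor [omegaS] by which [Gam]
    composed with [S] fails to invert [Gam]. *)
Definition omegaS' h : A := sw (Delta h) (fun x y => omega' x (S y)).
(** The last factor makes [coefS], and through it [Gaminv], absorb e on the right. *)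
Definition coefS h : A := sw (Delta h) (fun x y => omegaS' x * act y 1).
Definition Gaminv h : AH := sw (Delta h) (fun x y => Gam (S x) ** al (coefS y)).

Lemma Gaminv_lin : lin Gaminv. Proof. exact: (sw_lin hopfH). Qed.

Lemma in_cp_Gaminv h : in_cp Delta act (Gaminv h).
Proof. by apply: in_cp_sw => x y; apply: in_cpM; exact: in_cp_cp. Qed.

Lemma coefS_e h : sw (Delta h) (fun x y => coefS x * act y 1) = coefS h.
Proof.
transitivity (sw (Delta h) (fun x y => sw (Delta x) (fun p q => omegaS' p * act q 1 * act y 1))).
  by apply: eq_sw => x y; rewrite (lin_sw _ _ (lin_mull _ (@lin_id _ _))).
rewrite (swA h (fun p q y => omegaS' p * act q 1 * act y 1)); apply: eq_sw => p q.
rewrite -[in RHS]e_e (lin_sw _ _ (lin_mulr _ (@lin_id _ _))).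
by apply: eq_sw => r s; rewrite mulrA.
Qed.

Lemma Gaminv_e h : sw (Delta h) (fun x y => Gaminv x ** al (act y 1)) = Gaminv h.
Proof.
transitivity (sw (Delta h) (fun x y => sw (Delta x) (fun p q =>
    Gam (S p) ** al (coefS q) ** al (act y 1)))).
  by apply: eq_sw => x y; rewrite (lin_sw _ _ (cpmul_linl _)).
rewrite (swA h (fun p q y => Gam (S p) ** al (coefS q) ** al (act y 1))).
apply: eq_sw => p q; rewrite -[in RHS]coefS_e.
rewrite (lin_sw _ _ (lin_comp (cpmul_linr (Gam (S p))) al_lin)).
by apply: eq_sw => x y; rewrite -cpmulA alM.
Qed.

(** As [S] respects the coproduct, the product expands to omega(h1, S h2) Gam(h3 S h4) after
    reordering, and the antipode collapses the last factor to the unit. *)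
Lemma sw_Gam_GamS h : sw (Delta h) (fun x y => Gam x ** Gam (S y)) = al (omegaS h).
Proof.
transitivity (sw (Delta h) (fun x y => sw (Delta x) (fun p q => sw (Delta y) (fun r s =>
   lact (omega p (S r)) (Gam (q * S s)))))).
  apply: eq_sw => x y; rewrite Gam_Gam gamgamE; apply: eq_sw => p q /=.
  rewrite swS //; split=> z; last first.
    by apply: lin_comp (lact_linl _) _; exact: bilin2 omega_bilin.
  by apply: (lin_comp (lact_linr _)); apply: (lin_comp Gam_lin); exact: lin_mulr.
rewrite (swACA hopfH cocomm).
rewrite alE (lin_sw _ _ (lact_linl _)).
rewrite -(sw_eps_r hopfH cocomm h (f := fun h => sw (Delta h) (fun x y =>
    lact (omega x (S y)) (gam 1)))); last exact: (sw_lin hopfH).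
apply: eq_sw => x y; rewrite swZ; apply: eq_sw => p q.
by rewrite (swSr hopfH y (lin_comp (lact_linr (omega p (S q))) Gam_lin)) Gam1.
Qed.

Lemma sw_GamS_Gam h : sw (Delta h) (fun x y => Gam (S x) ** Gam y) =
  al (sw (Delta h) (fun x y => omega (S x) y)).
Proof.
transitivity (sw (Delta h) (fun x y => sw (Delta x) (fun p q => sw (Delta y) (fun r s =>
   lact (omega (S p) r) (Gam (S q * s)))))).
  apply: eq_sw => x y; rewrite Gam_Gam gamgamE /sw2 /sg_prod /= swS //.
  split=> z; apply: sw_lin_arg => p q; last first.
    by apply: lin_comp (lact_linl _) _; exact: bilin1 omega_bilin.
  by apply: (lin_comp (lact_linr _)); apply: (lin_comp Gam_lin); exact: lin_mull.
rewrite (swACA hopfH cocomm).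
rewrite alE (lin_sw _ _ (lact_linl _)).
rewrite -(sw_eps_r hopfH cocomm h (f := fun h => sw (Delta h) (fun x y =>
    lact (omega (S x) y) (gam 1)))); last exact: (sw_lin hopfH).
apply: eq_sw => x y; rewrite swZ; apply: eq_sw => p q.
by rewrite (swSl hopfH y (lin_comp (lact_linr (omega (S p) q)) Gam_lin)) Gam1.
Qed.

(** The sum is the convolution of [omega] and [omega'] at (h1, S h2), hence that of f1 and f2,
    namely (h1 . 1)(h2 S(h3) . 1) = h . 1. *)
Lemma omegaS_omegaS' h : sw (Delta h) (fun x y => omegaS x * omegaS' y) = act h 1.
Proof.
transitivity (sw (Delta h) (fun x y => sw (Delta x) (fun p q => sw (Delta y) (fun r s =>
   omega p (S q) * omega' r (S s))))).
  apply: eq_sw => x y; rewrite (lin_sw _ _ (lin_mull _ (@lin_id _ _))).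
  by apply: eq_sw => p q; rewrite (lin_sw _ _ (lin_mulr _ (@lin_id _ _))).
rewrite (swACA hopfH cocomm).
transitivity (sw (Delta h) (fun x y => conv2 Delta omega omega' x (S y))).
  apply: eq_sw => x y; apply: eq_sw => p q; rewrite swS //; split=> z.
    by apply: lin_mulr; exact: bilin2 omega'_bilin.
  by apply: lin_mull; exact: bilin2 omega_bilin.
rewrite omega_omega'.
transitivity (sw (Delta h) (fun x y => sw (Delta x) (fun p q => act p 1 * act (q * S y) 1))).
  apply: eq_sw => x y; apply: eq_sw => p q; rewrite /f1_map /f2_map.
  rewrite -(sw_eps hopfH (S y) (f := fun z => act p 1 * act (q * z) 1)); last first.
    by apply: lin_mulr; apply: (lin_comp (act_linl _)); exact: lin_mulr.
  by apply: eq_sw => r s; rewrite scalerAl.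
rewrite (swA h (fun p q y => act p 1 * act (q * S y) 1)).
rewrite -[RHS](sw_eps_r hopfH cocomm h (act_linl 1)); apply: eq_sw => x y.
by rewrite (swSr hopfH y (lin_mulr (act x 1) (act_linl 1))) act1 mulr1.
Qed.

(** [Gam] times [Gam] after [S] yields [omegaS], which [omegaS'] cancels up to e; the e in [coefS]
    then merges with this one by [e_e]. *)
Lemma sw_Gam_Gaminv h : sw (Delta h) (fun x y => Gam x ** Gaminv y) = al (act h 1).
Proof.
transitivity (sw (Delta h) (fun x y => sw (Delta y) (fun p q =>
    Gam x ** Gam (S p) ** al (coefS q)))).
  apply: eq_sw => x y; rewrite (lin_sw _ _ (cpmul_linr _)); apply: eq_sw => p q.
  by rewrite cpmulA.
rewrite -(swA h (fun x p q => Gam x ** Gam (S p) ** al (coefS q))).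
transitivity (al (sw (Delta h) (fun x y => omegaS x * coefS y))).
  rewrite (lin_sw _ _ al_lin); apply: eq_sw => x y.
  by rewrite -(lin_sw _ _ (cpmul_linl _)) sw_Gam_GamS alM.
congr (al _); rewrite -e_e.
transitivity (sw (Delta h) (fun x y => sw (Delta y) (fun p q => omegaS x * omegaS' p * act q 1))).
  apply: eq_sw => x y; rewrite (lin_sw _ _ (lin_mulr _ (@lin_id _ _))).
  by apply: eq_sw => p q; rewrite mulrA.
rewrite -(swA h (fun x p q => omegaS x * omegaS' p * act q 1)); apply: eq_sw => x y.
by rewrite -(lin_sw _ _ (lin_mull _ (@lin_id _ _))) omegaS_omegaS'.
Qed.

(** The element of A that [sw_Gaminv_al_Gam] identifies with Gaminv h1 a Gam h2. *)
Definition conjGam a h : A := sw (Delta h) (fun x y =>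
  sw (Delta x) (fun p q => act (S p) (coefS q * a)) * sw (Delta y) (fun r s => omega (S r) s)).

(** Moving [Gam (S p)] to the right of the coefficients in A brings it next to the final [Gam], and
    [sw_GamS_Gam] sends their product into A. *)
Lemma sw_Gaminv_al_Gam a h :
  sw (Delta h) (fun x y => Gaminv x ** al a ** Gam y) = al (conjGam a h).
Proof.
transitivity (sw (Delta h) (fun x y => sw (Delta x) (fun p q => sw (Delta p) (fun r s =>
    lact (act (S r) (coefS q * a)) (Gam (S s) ** Gam y))))).
  apply: eq_sw => x y; rewrite !(lin_sw _ _ (cpmul_linl _)); apply: eq_sw => p q.
  rewrite -cpmulA -cpmulA [al _ ** _]cpmulA alM cpmulA Gam_al swS; last first.
    split=> z; first exact: lin_comp (lact_linr _) Gam_lin.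
    exact: lin_comp (lact_linl _) (act_linl _).
  rewrite (lin_sw _ _ (cpmul_linl _)); apply: eq_sw => r s.
  by rewrite cpmul_lact.
transitivity (sw (Delta h) (fun x y => sw (Delta x) (fun p q => sw (Delta y) (fun s r =>
    lact (act (S p) (coefS q * a)) (Gam (S s) ** Gam r))))); last first.
  rewrite (lin_sw _ _ al_lin); apply: eq_sw => x y; rewrite -alM -sw_GamS_Gam.
  rewrite (lin_sw _ _ al_lin) (lin_sw _ _ (cpmul_linl _)); apply: eq_sw => p q.
  rewrite (lin_sw _ _ (cpmul_linr _)); apply: eq_sw => r s.
  by rewrite al_mul_cp //; apply: in_cpM; exact: in_cp_cp.
under [RHS]eq_sw => x y do rewrite sw_exch.
etransitivity; last exact: (swA h (fun x s r => sw (Delta x) (fun p q =>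
   lact (act (S p) (coefS q * a)) (Gam (S s) ** Gam r)))).
apply: eq_sw => x y.
exact: (swAC hopfH cocomm x (fun r s q => lact (act (S r) (coefS q * a)) (Gam (S s) ** Gam y))).
Qed.

(** * Casimir identities under A-balanced bilinear maps *)

Section Bilinear.
Variables (V : lmodType k) (beta : AH -> AH -> V) (c : A).
Hypothesis betaB : bilin beta.
Hypothesis beta_al : forall X Y a, in_cp Delta act X -> in_cp Delta act Y ->
  beta (X ** al a) Y = beta X (al a ** Y).
Hypothesis c_central : forall a, a * c = c * a.

Let beta1 X : lin (beta X) := betaB.1 X.
Let beta2 Y : lin (fun X => beta X Y) := betaB.2 Y.

(** The sum is Gam l1 Gaminv l2 a Gam l3 = (l1 . 1) a Gam l2; the first factor commutes with a and
    is absorbed by [Gam]. *)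
Lemma sw_Gam_conjGam a l :
  sw (Delta l) (fun x y => Gam x ** al (conjGam a y)) = al a ** Gam l.
Proof.
transitivity (sw (Delta l) (fun x y => sw (Delta y) (fun p q =>
    Gam x ** Gaminv p ** al a ** Gam q))).
  apply: eq_sw => x y; rewrite -sw_Gaminv_al_Gam (lin_sw _ _ (cpmul_linr _)).
  by apply: eq_sw => p q; rewrite !cpmulA.
rewrite -(swA l (fun x p q => Gam x ** Gaminv p ** al a ** Gam q)).
rewrite -[in RHS]Gam_e (lin_sw _ _ (cpmul_linr _)); apply: eq_sw => x q.
rewrite -(lin_sw _ _ (lin_comp (cpmul_linl (Gam q)) (cpmul_linl (al a)))).
rewrite sw_Gam_Gaminv alM act_central -alM -cpmulA [al (act x 1) ** _]al_mul_cp //.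
exact: in_cp_cp.
Qed.

(** By [sw_Gam_conjGam] the element a moves to the right of [Gam] as [conjGam]. It can then pass c,
    which is central, and cross the tensor sign. *)
Lemma beta_al_Gam a l Y : in_cp Delta act Y ->
  beta (al a ** Gam l ** al c) Y =
  sw (Delta l) (fun x y => sw (Delta y) (fun p q =>
    beta (Gam x ** al c) (Gaminv p ** al a ** Gam q ** Y))).
Proof.
move=> cpY; rewrite -sw_Gam_conjGam.
rewrite (lin_sw _ _ (lin_comp (beta2 Y) (cpmul_linl (al c)))); apply: eq_sw => x y.
rewrite -(lin_sw _ _ (lin_comp (beta1 (Gam x ** al c)) (cpmul_linl Y))).
rewrite sw_Gaminv_al_Gam -beta_al //; last by apply: in_cpM; exact: in_cp_cp.
by rewrite -!cpmulA !alM c_central.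
Qed.

(** After [beta_al_Gam] the second argument ends in a product of [Gam] and [Gaminv], which collapses
    to e; this central factor moves past a into [Gaminv]. *)
Lemma Casimir_al a t :
  sw (Delta t) (fun x y => beta (al a ** Gam x ** al c) (Gaminv y)) =
  sw (Delta t) (fun x y => beta (Gam x ** al c) (Gaminv y ** al a)).
Proof.
transitivity (sw (Delta t) (fun x y => sw (Delta x) (fun r s => sw (Delta s) (fun p q =>
    beta (Gam r ** al c) (Gaminv p ** al a ** Gam q ** Gaminv y))))).
  by apply: eq_sw => x y; rewrite beta_al_Gam //; exact: in_cp_Gaminv.
rewrite (swA t (fun r s y => sw (Delta s) (fun p q =>
    beta (Gam r ** al c) (Gaminv p ** al a ** Gam q ** Gaminv y)))).
apply: eq_sw => r s.
rewrite (swA s (fun p q y => beta (Gam r ** al c) (Gaminv p ** al a ** Gam q ** Gaminv y))).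
rewrite -[in RHS]Gaminv_e (lin_sw _ _ (lin_comp (beta1 (Gam r ** al c)) (cpmul_linl (al a)))).
apply: eq_sw => x y.
rewrite -cpmulA alM act_central -alM cpmulA -sw_Gam_Gaminv.
rewrite (lin_sw _ _ (cpmul_linr (Gaminv x ** al a))) (lin_sw _ _ (beta1 (Gam r ** al c))).
by apply: eq_sw => p q; rewrite !cpmulA.
Qed.

(** The coefficient [omega] of Gam h Gam l crosses to the second argument by [beta_al_Gam], where it
    reassembles with the remaining [Gam] into a product of two. *)
Lemma beta_Gam_Gam h l Y : in_cp Delta act Y ->
  beta (Gam h ** Gam l ** al c) Y =
  sw2 (h, l) (fun u v => sw2 u (fun p q =>
    beta (Gam (p.1 * p.2) ** al c) (Gaminv (q.1 * q.2) ** Gam v.1 ** Gam v.2 ** Y))).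
Proof.
move=> cpY.
have swE2 := sgE (sw2_sweedler hopfH cocomm).
pose F (o p q r : H * H) := beta (Gam (p.1 * p.2) ** al c)
  (Gaminv (q.1 * q.2) ** al (omega o.1 o.2) ** Gam (r.1 * r.2) ** Y).
transitivity (sw2 (h, l) (fun o w => sw2 w (fun p z => sw2 z (fun q r => F o p q r)))).
  rewrite Gam_Gam gamgamE.
  rewrite (lin_sw _ _ (lin_comp (beta2 Y) (cpmul_linl (al c)))); apply: eq_sw => x y.
  rewrite (lin_sw _ _ (lin_comp (beta2 Y) (cpmul_linl (al c)))); apply: eq_sw => x' y' /=.
  rewrite -al_mul_cp; last exact: in_cp_cp.
  rewrite beta_al_Gam // (swM hopfH); last first.
    split=> z; first exact: (sw_lin hopfH).
    apply: sw_lin_arg => p q.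
    exact: (lin_comp (beta2 _) (lin_comp (cpmul_linl (al c)) Gam_lin)).
  apply: eq_sw => p z; apply: eq_sw => p' z' /=; rewrite (swM hopfH) //; split=> w.
    exact: (lin_comp (beta1 _) (lin_comp (cpmul_linl Y) (lin_comp (cpmul_linr _) Gam_lin))).
  exact: (lin_comp (beta1 _) (lin_comp (cpmul_linl Y)
    (lin_comp (cpmul_linl _) (lin_comp (cpmul_linl _) Gaminv_lin)))).
(* Now the arguments [o] of [omega] and [r] of the last [Gam] are the two legs of one pair, so
   [gamgamE] can be read backwards. *)
rewrite (sw2CAA hopfH cocomm); apply: (swE2) => u [v v'].
apply: (swE2) => -[p p'] [q q'] /=.
rewrite -cpmulA -cpmulA [_ ** (Gam v' ** Y)]cpmulA Gam_Gam gamgamE.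
rewrite (lin_sw _ _ (lin_comp (beta1 _) (lin_comp (cpmul_linr _) (cpmul_linl Y)))).
apply: eq_sw => o r.
rewrite (lin_sw _ _ (lin_comp (beta1 _) (lin_comp (cpmul_linr _) (cpmul_linl Y)))).
apply: eq_sw => o' r' /=; rewrite /F /= -al_mul_cp; last exact: in_cp_cp.
by rewrite !cpmulA.
Qed.

Lemma Casimir_Gam h t : left_integral eps t ->
  sw (Delta t) (fun x y => beta (Gam h ** Gam x ** al c) (Gaminv y)) =
  sw (Delta t) (fun x y => beta (Gam x ** al c) (Gaminv y ** Gam h)).
Proof.
move=> tI.
have swE2 := sgE (sw2_sweedler hopfH cocomm).
(* After [beta_Gam_Gam], the product of [Gam] and [Gaminv] on the last legs of [t] collapses to the
   value of e at [y']. *)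
transitivity (sw (Delta h) (fun x y => sw (Delta t) (fun x' y' => sw2 (x, x') (fun p q =>
    beta (Gam (p.1 * p.2) ** al c) (Gaminv (q.1 * q.2) ** Gam y ** al (act y' 1)))))).
  rewrite [RHS]sw_exch.
  transitivity (sw (Delta t) (fun x' y' => sw (Delta x') (fun l s => sw (Delta h) (fun x y =>
    sw2 (x, l) (fun p q => beta (Gam (p.1 * p.2) ** al c)
       (Gaminv (q.1 * q.2) ** Gam y ** Gam s ** Gaminv y')))))).
    apply: eq_sw => x' y'; rewrite beta_Gam_Gam; last exact: in_cp_Gaminv.
    by rewrite [RHS]sw_exch.
  rewrite (swA t (fun l s y' => sw (Delta h) (fun x y =>
    sw2 (x, l) (fun p q => beta (Gam (p.1 * p.2) ** al c)
       (Gaminv (q.1 * q.2) ** Gam y ** Gam s ** Gaminv y'))))).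
  apply: eq_sw => l z; rewrite sw_exch; apply: eq_sw => x y.
  rewrite sw_exch; apply: eq_sw => p q; rewrite sw_exch; apply: eq_sw => p' q' /=.
  rewrite -sw_Gam_Gaminv (lin_sw _ _ (cpmul_linr (Gaminv (q * q') ** Gam y))).
  rewrite (lin_sw _ _ (beta1 _)).
  by apply: eq_sw => r s; rewrite !cpmulA.
(* [Gam_al_act] carries this value to the left of [Gam], where it becomes e of a product of a leg of
   [h] and a leg of [t]. *)
transitivity (sw (Delta h) (fun x s => sw2 (x, t) (fun p z => sw2 z (fun q r =>
    beta (Gam (p.1 * p.2) ** al c)
      (Gaminv (q.1 * q.2) ** al (act (r.1 * r.2) 1) ** Gam s))))).
  transitivity (sw (Delta h) (fun x y => sw (Delta y) (fun r s =>
    sw (Delta t) (fun x' y' => sw2 (x, x') (fun p q => beta (Gam (p.1 * p.2) ** al c)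
       (Gaminv (q.1 * q.2) ** al (act (r * y') 1) ** Gam s)))))).
    apply: eq_sw => x y; rewrite [RHS]sw_exch; apply: eq_sw => x' y'.
    rewrite [RHS]sw_exch; apply: eq_sw => p q.
    rewrite [RHS]sw_exch; apply: eq_sw => p' q' /=.
    rewrite -cpmulA Gam_al_act (lin_sw _ _ (cpmul_linr (Gaminv (q * q')))).
    rewrite (lin_sw _ _ (beta1 _)); apply: eq_sw => r s.
    by rewrite -al_mul_cp ?cpmulA //; exact: in_cp_cp.
  etransitivity; first (symmetry; exact: (swA h (fun x r s =>
    sw (Delta t) (fun x' y' => sw2 (x, x') (fun p q => beta (Gam (p.1 * p.2) ** al c)
       (Gaminv (q.1 * q.2) ** al (act (r * y') 1) ** Gam s)))))).
  apply: eq_sw => x s.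
  rewrite -(sgA (sw2_sweedler hopfH cocomm) (x, t) (fun p q r =>
    beta (Gam (p.1 * p.2) ** al c)
      (Gaminv (q.1 * q.2) ** al (act (r.1 * r.2) 1) ** Gam s))).
  by [].
(* In this form the factor is absorbed by the neighbouring [Gaminv], whose argument is a product of
   the same kind. *)
transitivity (sw (Delta h) (fun x s => sw2 (x, t) (fun p z =>
    beta (Gam (p.1 * p.2) ** al c) (Gaminv (z.1 * z.2) ** Gam s)))).
  apply: eq_sw => x s; apply: (swE2) => p [z z'] /=.
  rewrite -[in RHS]Gaminv_e (swM hopfH); last first.
    split=> w; first exact: (lin_comp (cpmul_linr _) (lin_comp al_lin (act_linl 1))).
    exact: (lin_comp (cpmul_linl _) Gaminv_lin).
  rewrite (lin_sw _ _ (lin_comp (beta1 _) (cpmul_linl (Gam s)))); apply: eq_sw => q r.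
  by rewrite (lin_sw _ _ (lin_comp (beta1 _) (cpmul_linl (Gam s)))).
transitivity (sw (Delta h) (fun x s => sw (Delta (x * t)) (fun p z =>
    beta (Gam p ** al c) (Gaminv z ** Gam s)))).
  apply: eq_sw => x s; rewrite (swM hopfH) //; split=> w.
    exact: (lin_comp (beta1 _) (lin_comp (cpmul_linl (Gam s)) Gaminv_lin)).
  exact: (lin_comp (beta2 _) (lin_comp (cpmul_linl (al c)) Gam_lin)).
(* A counit is inserted on the right so that both sides run over the coproduct of [h]; the integral
   property x t = eps(x) t then matches them. *)
rewrite -(sw_eps hopfH h (f := fun s => sw (Delta t) (fun x y =>
   beta (Gam x ** al c) (Gaminv y ** Gam s)))); last first.
  apply: sw_lin_arg => x y; exact: (lin_comp (beta1 _) (lin_comp (cpmul_linr _) Gam_lin)).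
apply: eq_sw => x s; rewrite tI.
by rewrite (linZ (sw_lin hopfH (fun p z => beta (Gam p ** al c) (Gaminv z ** Gam s)))).
Qed.

End Bilinear.

Lemma sw_Gam_al_Gaminv c t :
  sw (Delta t) (fun x y => Gam x ** al c ** Gaminv y) = al (act t c).
Proof.
transitivity (sw (Delta t) (fun x y => sw (Delta x) (fun p q =>
    lact (act p c) (Gam q ** Gaminv y)))).
  apply: eq_sw => x y; rewrite Gam_al (lin_sw _ _ (cpmul_linl (Gaminv y))).
  by apply: eq_sw => p q; rewrite cpmul_lact.
rewrite (swA t (fun p q y => lact (act p c) (Gam q ** Gaminv y))).
(* Writing [c] as [c * 1] makes [actM] supply the factor [act y 1] that [sw_Gam_Gaminv] produces. *)
rewrite -[in RHS](mulr1 c) actM (lin_sw _ _ al_lin); apply: eq_sw => x y.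
by rewrite -(lin_sw _ _ (lact_linr _)) sw_Gam_Gaminv !alE lactA.
Qed.

(** * Testing equality in the tensor product over A *)

Definition tensA_coord X Y : {ffun 'I_(@dimH k H) -> AH} := [ffun j => X ** al (Y j)].

Lemma tensA_coord_bilin : bilin tensA_coord.
Proof.
split=> [X|Y] b Z W; apply/ffunP => j; rewrite !ffunE; last exact: cpmul_linl.
by rewrite al_lin cpmul_linr.
Qed.

Lemma tensA_coord_al X Y a : in_cp Delta act Y ->
  tensA_coord (X ** al a) Y = tensA_coord X (al a ** Y).
Proof.
by move=> cpY; apply/ffunP => j; rewrite !ffunE al_mul_cp // ffunE -alM cpmulA.
Qed.

(** Expanding [Y] along the elements [Gam (bas j)] and moving its coefficients across the tensor
    sign shows that every balanced map factors through [tensA_coord]. *)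
Lemma balanced_tensA_coord (M : zmodType) (beta : AH -> AH -> M) X Y :
  balanced Delta act omega beta -> in_cp Delta act X -> in_cp Delta act Y ->
  beta X Y = \sum_j beta (tensA_coord X Y j) (Gam (bas j)).
Proof.
move=> [_ betaD beta_al] cpX /in_cpP YE.
have cp0 : in_cp Delta act 0 by exists [::]; rewrite big_nil.
have beta0 : beta X 0 = 0.
  by apply: (addrI (beta X 0)); rewrite -betaD // !addr0.
rewrite -{1}YE lmul1_expand.
(* Additivity of [beta] is available on A#H only, so the induction also carries membership of the
   partial sums. *)
have [_ ->] : in_cp Delta act (\sum_j cp (Y j) (bas j)) /\
    beta X (\sum_j cp (Y j) (bas j)) = \sum_j beta X (cp (Y j) (bas j)).
  elim: (index_enum _) => [|j r [cpr IH]]; first by rewrite !big_nil.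
  rewrite !big_cons betaD ?IH //; last exact: in_cp_cp.
  by split=> //; rewrite -[cp _ _]scale1r; apply: in_cpL => //; exact: in_cp_cp.
apply: eq_bigr => j _; rewrite ffunE beta_al //; last exact: in_cp_cp.
by rewrite al_mul_cp -?cpE //; exact: in_cp_cp.
Qed.

(** A balanced map is merely additive, whereas the Casimir identities concern k-bilinear maps; this
    passes from the former to the bilinear [tensA_coord]. *)
Lemma tensA_eq_coord (s1 s2 : seq (AH * AH)) :
  (forall p, p \in s1 -> in_cp Delta act p.1 /\ in_cp Delta act p.2) ->
  (forall p, p \in s2 -> in_cp Delta act p.1 /\ in_cp Delta act p.2) ->
  \sum_(p <- s1) tensA_coord p.1 p.2 = \sum_(p <- s2) tensA_coord p.1 p.2 ->
  tensA_eq Delta act omega s1 s2.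
Proof.
move=> cp1 cp2 phiE M beta betaB.
have betaE (s : seq (AH * AH)) :
    (forall p, p \in s -> in_cp Delta act p.1 /\ in_cp Delta act p.2) ->
    \sum_(p <- s) beta p.1 p.2 =
    \sum_j beta ((\sum_(p <- s) tensA_coord p.1 p.2) j) (Gam (bas j)).
  have [betaD _ _] := betaB.
  have cp0 : in_cp Delta act 0 by exists [::]; rewrite big_nil.
  have beta0 Y : in_cp Delta act Y -> beta 0 Y = 0.
    by move=> cpY; apply: (addrI (beta 0 Y)); rewrite -betaD // !addr0.
  elim: s => [_|[X Y] s IHs cps].
    by rewrite big_nil big1 // => j _; rewrite big_nil ffunE beta0 //; exact: in_cp_cp.
  have [/= cpX cpY] := cps _ (mem_head _ _).
  have cps' p : p \in s -> in_cp Delta act p.1 /\ in_cp Delta act p.2.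
    by move=> ps; apply: cps; rewrite inE ps orbT.
  rewrite big_cons IHs //= (balanced_tensA_coord betaB) // -big_split.
  apply: eq_bigr => j _ /=.
  have addE (u v : {ffun 'I_(@dimH k H) -> AH}) : (u + v) j = u j + v j by rewrite ffunE.
  rewrite big_cons addE betaD //; last exact: in_cp_cp.
    by rewrite ffunE; exact: in_cpM.
  rewrite sum_ffunE big_seq; elim/big_ind: _ => [//|Z W cpZ cpW|p /cps' [cpp _]].
    by rewrite -[Z]scale1r; exact: in_cpL.
  by rewrite ffunE; exact: in_cpM.
by rewrite !betaE // phiE.
Qed.

(** * The separability element *)

Lemma sum_Casimir (V : lmodType k) (t : H) (c : A) (f : AH -> AH -> V) :
  (forall Y, lin (fun X => f X Y)) ->
  \sum_(ij : 'I_(@dimH k H) * 'I_(@dimH k H))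
     f (Delta t ij.1 ij.2 *: (Gam (bas ij.1) ** al c)) (Gaminv (bas ij.2)) =
  sw (Delta t) (fun x y => f (Gam x ** al c) (Gaminv y)).
Proof. by move=> fL; rewrite sw_pair; apply: eq_bigr => p _; rewrite (linZ (fL _)). Qed.

Lemma separable_of_integral t c : left_integral eps t -> (forall a, a * c = c * a) ->
  act t c = 1 -> separable_cp Delta act omega.
Proof.
move=> tI cC tc.
pose el (ij : 'I_(@dimH k H) * 'I_(@dimH k H)) :=
  (Delta t ij.1 ij.2 *: (Gam (bas ij.1) ** al c), Gaminv (bas ij.2)).
have cpl ij : in_cp Delta act (el ij).1.
  rewrite -[(el ij).1]addr0; apply: in_cpL; first by apply: in_cpM; exact: in_cp_cp.
  by exists [::]; rewrite big_nil.
have cpr ij : in_cp Delta act (el ij).2 by exact: in_cp_Gaminv.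
exists [seq el ij | ij <- index_enum ('I_(@dimH k H) * 'I_(@dimH k H))%type]; split.
- by move=> _ /mapP[ij _ ->].
- move=> x cpx; apply: tensA_eq_coord.
  + move=> _ /mapP[_ /mapP[ij _ ->] ->].
    by split; [exact: in_cpM | exact: cpr].
  + move=> _ /mapP[_ /mapP[ij _ ->] ->].
    by split; [exact: cpl | apply: in_cpM; exact: cpr].
  rewrite !big_map /=.
  have [phi1 phi2] := tensA_coord_bilin.
  have lin1 z : forall Y, lin (fun X => tensA_coord (z ** X) Y).
    by move=> Y; exact: (lin_comp (phi2 Y) (cpmul_linr z)).
  have lin2 z : forall Y, lin (fun X => tensA_coord X (Y ** z)) by move=> Y; exact: phi2.
  rewrite (sum_Casimir t c (lin1 x)) (sum_Casimir t c (lin2 x)).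
  (* Rewriting [x] as [lmul 1 x] expresses it as a sum of elements a # h, so by linearity one such
     element suffices. *)
  have /in_cpP <- := cpx.
  pose F1 z := sw (Delta t) (fun u v => tensA_coord (z ** (Gam u ** al c)) (Gaminv v)).
  pose F2 z := sw (Delta t) (fun u v => tensA_coord (Gam u ** al c) (Gaminv v ** z)).
  have F1L : lin F1.
    by apply: sw_lin_arg => u v; exact: (lin_comp (phi2 _) (cpmul_linl _)).
  have F2L : lin F2.
    by apply: sw_lin_arg => u v; exact: (lin_comp (phi1 _) (cpmul_linr _)).
  rewrite -/(F1 (lmul 1 x)) -/(F2 (lmul 1 x)) lmul1_expand.
  rewrite (lin_sum _ _ _ F1L) (lin_sum _ _ _ F2L).
  apply: eq_bigr => j _; move: (x j) (bas j) => a h.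
  rewrite cpE -al_mul_cp; last exact: in_cp_cp.
  (* For a # h = a Gam h the two factors cross one at a time: [f1] keeps a on the left while [Gam h]
     crosses, then [f2] keeps [Gam h] on the right while a crosses. *)
  pose f1 X Y := tensA_coord (al a ** X) Y; pose f2 X Y := tensA_coord X (Y ** Gam h).
  have f1B : bilin f1 by split=> z; [exact: phi1 | exact: lin1].
  have f2B : bilin f2.
    by split=> z; [exact: (lin_comp (phi1 _) (cpmul_linl _)) | exact: phi2].
  have f1_al X Y b : in_cp Delta act X -> in_cp Delta act Y ->
      f1 (X ** al b) Y = f1 X (al b ** Y).
    by move=> cpX cpY; rewrite /f1 cpmulA tensA_coord_al.
  have f2_al X Y b : in_cp Delta act X -> in_cp Delta act Y ->
      f2 (X ** al b) Y = f2 X (al b ** Y).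
    by move=> cpX cpY; rewrite /f2 -cpmulA tensA_coord_al //; exact: in_cpM.
  transitivity (sw (Delta t) (fun u v => f1 (Gam h ** Gam u ** al c) (Gaminv v))).
    by apply: eq_sw => u v; rewrite /f1 !cpmulA.
  etransitivity; first exact: (Casimir_Gam f1B f1_al cC h tI).
  transitivity (sw (Delta t) (fun u v => f2 (al a ** Gam u ** al c) (Gaminv v))).
    by apply: eq_sw => u v; rewrite /f1 /f2 !cpmulA.
  etransitivity; first exact: (Casimir_al f2B f2_al cC a t).
  by apply: eq_sw => u v; rewrite /f2 !cpmulA.
rewrite big_map /= (sum_Casimir t c cpmul_linl) sw_Gam_al_Gaminv tc //.
Qed.

End CrossedProduct.

Theorem theorem6p2 (k : fieldType) (H : falgType k)
    (Delta : H -> 'M[k]_(@dimH k H)) (eps : H -> k) (S : H -> H)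
    (A : algType k) (act : H -> A -> A) (omega omega' : H -> H -> A)
    (t : H) (c : A) :
  is_hopf Delta eps S ->
  cocommutative Delta ->
  symmetric_tpa Delta eps act omega omega' ->
  left_integral eps t -> t != 0 ->
  (forall a : A, a * c = c * a) ->
  act t c = 1 ->
  separable_cp Delta act omega.
Proof.
move=> hopfH cocomm symA tI _ cC tc.
exact: (separable_of_integral hopfH cocomm symA tI cC tc).
Qed.
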